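(* Let $g>1$ be an integer and let $B_g$ be the bouquet of $g$ circles, with its full symmetry group $\mathrm{Sym}(B_g)$ acting on it. Then the minimal integer $n\ge 0$ such that there is an equivariant embedding $B_g\to S^n$ is $n=2g-1$.
   Context: The bouquet of $g$ circles $B_g$ is the graph with one vertex $v$ and $g$ closed edges (oriented circles) $C_1,\dots,C_g$. Concretely, $B_g$ is the quotient space of $\{1,\dots,g\}\times\{z\in\mathbb{C}:|z|=1\}$ obtained by identifying all the points $(i,1)$, $1\le i\le g$, to the single point $v$. Write $[i,z]$ for the class of $(i,z)$, and let $C_i$ be the image of $\{i\}\times\{|z|=1\}$. The full symmetry group $\mathrm{Sym}(B_g)$ is the finite group of homeomorphisms of $B_g$ generated by the following elements: - for each permutation $\sigma\in S_g$, the map $\tau_\sigma([j,z])=[\sigma(j),z]$, which permutes the oriented circles and preserves their orientations; - for each $i\in\{1,\dots,g\}$, the map $\rho_i$ with $\rho_i([i,z])=[i,\bar z]$ and $\rho_i([j,z])=[j,z]$ for $j\neq i$, which is an orientation-reversing involution on $C_i$ and the identity on the other circles. It is the semidirect product $(\mathbb{Z}_2)^g\ltimes S_g$, with normal subgroup $(\mathbb{Z}_2)^g$ generated by the $\rho_i$, and has order $2^g g!$. $S^n$ denotes the unit sphere in $\mathbb{R}^{n+1}$, and $O(n+1)$ is the orthogonal group acting on $\mathbb{R}^{n+1}$ and hence on $S^n$. Group actions are faithful. An equivariant embedding $B_g\to S^n$ means a $\mathrm{Sym}(B_g)$-equivariant embedding. That is, it is a topological embedding $e:B_g\to S^n$ for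 which there is an injective group homomorphism $\varphi:\mathrm{Sym}(B_g)\to O(n+1)$ such that $\varphi(h)(e(x))=e(h(x))$ for all $x\in B_g$ and all $h\in\mathrm{Sym}(B_g)$. *)

(* Defs.v *)
From HB Require Import structures.
From mathcomp Require Import all_boot all_order all_algebra fingroup perm.
From mathcomp Require Import all_classical all_reals all_analysis.
From mathcomp Require Import complex wedge_sigT.
Set Implicit Arguments.
Unset Strict Implicit.
Unset Printing Implicit Defensive.
Import Order.TTheory GRing.Theory Num.Theory numFieldNormedType.Exports.
Local Open Scope classical_set_scope.
Local Open Scope ring_scope.

(* The ascription to numClosedFieldType selects MathComp-Analysis's topology
   of the norm on complex numbers. *)
Definition Cplx (R : realType) : numClosedFieldType := R[i].

Lemma conj_continuous (C : numClosedFieldType) :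
  continuous (fun w : C => w^*).
Proof.
move=> z; apply/(cvgrPdist_lt (F := nbhs z)) => e e0; near=> w.
rewrite -rmorphB norm_conjC; near: w.
exact: (cvgr_dist_lt (F := nbhs z)).
Unshelve. all: by end_near. Qed.

Definition circle (R : realType) : set (Cplx R) := [set z | `|z| = 1].
Arguments circle R : clear implicits.

Section circle.
Variable R : realType.

Lemma circle_one_subproof : (1 : Cplx R) \in circle R.
Proof. by rewrite inE /circle /= normr1. Qed.

Definition circle_one : circle R := SigSub circle_one_subproof.

Lemma circle_conj_subproof (z : circle R) : (val z)^* \in circle R.
Proof. by have := set_mem (valP z); rewrite inE /circle /= norm_conjC. Qed.

Definition circle_conj (z : circle R) : circle R :=
  SigSub (circle_conj_subproof z).

Lemma circle_conj1 : circle_conj circle_one = circle_one.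
Proof. by apply: val_inj; rewrite /= rmorph1. Qed.

Lemma circle_conjK : involutive circle_conj.
Proof. by move=> z; apply: val_inj; rewrite /= conjCK. Qed.

Lemma circle_conj_continuous : continuous circle_conj.
Proof.
apply/continuous_comp_initial => z.
apply: (@continuous_comp _ _ _ (set_val : circle R -> Cplx R)
  (fun w : Cplx R => w^*)); first exact: initial_continuous.
exact: conj_continuous.
Qed.

End circle.

(* [wedge] is the quotient of {i : 'I_g & circle R}, i.e. of the product of the
   circle with a discrete index set, that identifies all the points (i, 1). *)
Definition bouquet (R : realType) (g : nat) : Type :=
  wedge (fun _ : 'I_g => circle_one R).

HB.instance Definition _ (R : realType) (g : nat) :=
  Topological.copy (bouquet R g) (wedge (fun _ : 'I_g => circle_one R)).

Section bouquet.
Variables (R : realType) (g : nat).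
Local Notation B := (bouquet R g).

Definition bq_pt (i : 'I_g) (z : circle R) : B :=
  @wedge_lift _ _ (fun _ : 'I_g => circle_one R) i z.

Lemma bq_pt1 i j : bq_pt i (circle_one R) = bq_pt j (circle_one R).
Proof.
exact: (@wedge_liftE _ _ (fun _ : 'I_g => circle_one R) j
  (circle_one R) i (circle_one R)).
Qed.

Lemma bq_ptP (x : B) : exists i z, x = bq_pt i z.
Proof.
have : (\bigcup_i (bq_pt i @` setT)) x.
  by rewrite (@wedgeTE _ _ (fun _ : 'I_g => circle_one R)).
by case=> i _ [z _ <-]; exists i, z.
Qed.

Lemma bq_pt_continuous i : continuous (bq_pt i).
Proof.
exact: (@wedge_lift_continuous _ _ (fun _ : 'I_g => circle_one R) i).
Qed.

(* [wedge_fun f] descends [f] to the wedge through chosen representatives, so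
   tauE and rhoE, which do not depend on that choice, are the defining
   formulas of tau and rho. *)
Definition tau (s : 'S_g) : B -> B :=
  wedge_fun (fun j z => bq_pt (s j) z).

Definition rho (i : 'I_g) : B -> B :=
  wedge_fun (fun j z => bq_pt j (if j == i then circle_conj z else z)).

Lemma tauE s j z : tau s (bq_pt j z) = bq_pt (s j) z.
Proof.
apply: (@wedge_lift_funE _ _ (fun _ : 'I_g => circle_one R)) => *.
exact: bq_pt1.
Qed.

Lemma rhoE i j z :
  rho i (bq_pt j z) = bq_pt j (if j == i then circle_conj z else z).
Proof.
apply: (@wedge_lift_funE _ _ (fun _ : 'I_g => circle_one R)) => k l.
by rewrite circle_conj1 !if_same; exact: bq_pt1.
Qed.

End bouquet.

Definition homeomorphism (T : topologicalType) (h : T -> T) : Prop :=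
  continuous h /\ exists k : T -> T, [/\ continuous k, cancel h k & cancel k h].

Inductive generated (T : Type) (S : set (T -> T)) : set (T -> T) :=
| generated_gen h : S h -> generated S h
| generated_id : generated S id
| generated_comp h k : generated S h -> generated S k -> generated S (h \o k)
| generated_inv h k :
    generated S h -> cancel h k -> cancel k h -> generated S k.

Definition SymB (R : realType) (g : nat) : set (bouquet R g -> bouquet R g) :=
  generated (range (@tau R g) `|` range (@rho R g)).
Arguments SymB R g : clear implicits.

Section SymB.
Variables (R : realType) (g : nat).

Lemma tau_continuous s : continuous (@tau R g s).
Proof.
apply: wedge_fun_continuous => [j|j k]; first exact: bq_pt_continuous.
exact: bq_pt1.
Qed.

Lemma rho_continuous i : continuous (@rho R g i).
Proof.
apply: wedge_fun_continuous => [j|j k].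
  case: (j == i); last exact: bq_pt_continuous.
  move=> z; apply: (@continuous_comp _ _ _ (@circle_conj R) (@bq_pt R g j)).
    exact: circle_conj_continuous.
  exact: bq_pt_continuous.
by rewrite circle_conj1 !if_same; exact: bq_pt1.
Qed.

Lemma tauK s : cancel (@tau R g s) (tau s^-1%g).
Proof. by move=> x; have [i [z ->]] := bq_ptP x; rewrite !tauE permK. Qed.

Lemma rhoK i : involutive (@rho R g i).
Proof.
move=> x; have [j [z ->]] := bq_ptP x; rewrite !rhoE.
by case: (j == i); rewrite ?circle_conjK.
Qed.

Lemma SymB_homeomorphism h : SymB R g h -> homeomorphism h.
Proof.
elim=> {h} [h|||].
- case=> [[s _ <-]|[i _ <-]]; split.
  + exact: tau_continuous.
  + exists (tau s^-1%g); split; [exact: tau_continuous|exact: tauK|].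
    by rewrite -{2}[s]invgK; exact: tauK.
  + exact: rho_continuous.
  + by exists (rho i); split; [exact: rho_continuous|exact: rhoK|exact: rhoK].
- by split; [move=> x; exact: cvg_id|exists id; split => // x; exact: cvg_id].
- move=> h k _ [ch [h' [ch' hK h'K]]] _ [ck [k' [ck' kK k'K]]]; split.
    by move=> x; apply: continuous_comp; [exact: ck|exact: ch].
  exists (k' \o h'); split; [|exact: can_comp|exact: can_comp].
  by move=> x; apply: continuous_comp; [exact: ch'|exact: ck'].
- move=> h k _ [ch [h' [ch' hK h'K]]] hk kh.
  have -> : k = h' by apply/funext => x; rewrite -{1}(h'K x) hk.
  by split=> //; exists h.
Qed.

End SymB.

(* The topology of 'cV[R]_n.+1 is that of the sup norm, i.e. the usual one. *)
Definition sphere (R : realType) (n : nat) : set 'cV[R]_n.+1 :=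
  [set x | \sum_(i < n.+1) x i 0 ^+ 2 = 1].
Arguments sphere R n : clear implicits.

Definition orthogonal_group (R : realType) (n : nat) : set 'M[R]_n :=
  [set A | A^T *m A = 1%:M].
Arguments orthogonal_group R n : clear implicits.

Definition topological_embedding (X Y : topologicalType) (e : X -> Y) : Prop :=
  [/\ continuous e, injective e &
      forall U : set X, open U ->
        exists2 V : set Y, open V & e @` U = V `&` range e].

(* The homomorphism phi is a total function on maps of the bouquet; only its
   values on SymB R g are constrained. *)
Definition equivariant_embedding (R : realType) (g n : nat)
    (e : bouquet R g -> sphere R n) : Prop :=
  topological_embedding e /\
  exists phi : (bouquet R g -> bouquet R g) -> 'M[R]_n.+1,
    [/\ forall h, SymB R g h -> orthogonal_group R n.+1 (phi h),
        forall h k, SymB R g h -> SymB R g k ->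
          phi (h \o k) = phi h *m phi k,
        forall h k, SymB R g h -> SymB R g k -> phi h = phi k -> h = k &
        forall h x, SymB R g h -> phi h *m val (e x) = val (e (h x))].

(* Main.v *)
(* Lower bound: each e([i, 'i]) - e([i, -'i]) is negated by rho_i and fixed by
   the other reflections, so these g vectors are independent of each other and
   of the space fixed by all the reflections. That space contains the g
   distinct points e([i, -1]), which S_g permutes, and the nonzero vector e(v),
   which S_g fixes. A transposition applied to a linear relation between them
   shows that all the coefficients of the e([i, -1]) are equal, hence that they
   span, together with e(v), a space of dimension at least g.

   Upper bound: B_g embeds in the product of g circles, hence in C^g = R^(2g),
   where all the points of the product have norm sqrt g. Both kinds of
   generators act by signed permutations of the 2g coordinates; as the image
   spans R^(2g), the matrix representing an element of Sym(B_g) is unique, which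
   makes the choice of a matrix for each element a homomorphism. *)
Require Import Defs.
From mathcomp Require Import all_boot all_order all_algebra fingroup perm.
From mathcomp Require Import all_classical all_reals all_analysis.
From mathcomp Require Import complex wedge_sigT.
Set Implicit Arguments.
Unset Strict Implicit.
Unset Printing Implicit Defensive.
Import Order.TTheory GRing.Theory Num.Theory numFieldNormedType.Exports.
Local Open Scope classical_set_scope.
Local Open Scope ring_scope.

(** * Linear algebra behind the lower bound *)

Section linear_independence.
Variables (F : numFieldType) (m g : nat).
Implicit Types (w p : 'I_g -> 'cV[F]_m) (S : 'I_g -> 'M[F]_m).

(** Applying [1%:M - S i] to the relation kills [q] and every [w j] with [j != i], and doubles
    [w i]. *)
Lemma reflections_free S w q (a : 'I_g -> F) :
  (forall i j, S i *m w j = if j == i then - w j else w j) ->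
  (forall i, w i != 0) -> (forall i, S i *m q = q) ->
  \sum_i a i *: w i + q = 0 -> forall i, a i = 0.
Proof.
move=> Sw w0 Sq rel i; have : (1%:M - S i) *m (\sum_j a j *: w j + q) = 0.
  by rewrite rel mulmx0.
rewrite mulmxDr mulmxBl mul1mx mulmxBl mul1mx Sq subrr addr0 mulmx_sumr -sumrB.
rewrite (bigD1 i)//= big1 => [|j ji]; last first.
  by rewrite -scalemxAr Sw (negPf ji) subrr.
rewrite -scalemxAr Sw eqxx scalerN opprK addr0 -mulr2n -scaler_nat => /eqP.
by rewrite !scaler_eq0 pnatr_eq0 (negPf (w0 i)) orbF => /eqP.
Qed.

(** Applying [1%:M - T (tperm i j)] to the relation leaves only [(c i - c j) *: (p i - p j)]. *)
Lemma permuted_coefs_eq (T : 'S_g -> 'M[F]_m) p q (c : 'I_g -> F) :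
  (forall s j, T s *m p j = p (s j)) -> injective p ->
  (forall s, T s *m q = q) ->
  \sum_i c i *: p i + q = 0 -> forall i j, c i = c j.
Proof.
move=> Tp pI Tq rel i j; have [->//|ij] := eqVneq i j.
have : (1%:M - T (tperm i j)) *m (\sum_k c k *: p k + q) = 0.
  by rewrite rel mulmx0.
rewrite mulmxDr mulmxBl mul1mx mulmxBl mul1mx Tq subrr addr0 mulmx_sumr -sumrB.
rewrite (bigD1 i)//= (bigD1 j) 1?eq_sym//=.
rewrite big1 => [|k /andP[ki kj]]; last first.
  by rewrite -scalemxAr Tp tpermD 1?eq_sym// subrr.
rewrite -!scalemxAr !Tp tpermL tpermR -!scalerBr addr0.
rewrite -(opprB (p i)) scalerN -scalerBl => /eqP.
by rewrite scaler_eq0 !subr_eq0 (inj_eq pI) (negPf ij) orbF => /eqP.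
Qed.

Lemma signed_permutation_dim (S : 'I_g -> 'M[F]_m) (T : 'S_g -> 'M[F]_m)
    (w p : 'I_g -> 'cV[F]_m) (p0 : 'cV[F]_m) : (0 < g)%N ->
  (forall i j, S i *m w j = if j == i then - w j else w j) ->
  (forall i j, S i *m p j = p j) -> (forall i, S i *m p0 = p0) ->
  (forall s j, T s *m p j = p (s j)) -> (forall s, T s *m p0 = p0) ->
  (forall i, w i != 0) -> injective p -> p0 != 0 -> (g + g <= m)%N.
Proof.
move=> g0 Sw Sp Sp0 Tp Tp0 w0 pI p00.
(* The [w i] are independent of the vectors fixed by all the [S i]. As the
   only possible relation between the [p i] is [\sum_i p i = 0], subtracting
   their mean and adding [p0] gives [g] independent vectors [u i]. *)
pose u i := g%:R *: p i - \sum_j p j + p0.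
pose A := col_mx (\matrix_(i < g) (w i)^T) (\matrix_(i < g) (u i)^T).
suff /eqP <- : row_free A by exact: rank_leq_col.
apply: inj_row_free => v; rewrite -[v]hsubmxK mul_row_col.
set a := lsubmx v; set b := rsubmx v.
rewrite [X in X + _]mulmx_sum_row [X in _ + X]mulmx_sum_row => rel.
have {}rel : \sum_i a 0 i *: w i + \sum_i b 0 i *: u i = 0.
  apply: trmx_inj; rewrite trmx0 -rel linearD !linear_sum /=; congr (_ + _);
  by apply: eq_bigr => i _; rewrite linearZ rowK.
(* The [u] part of the relation is fixed by all the [S i], so it can play the role of [q] in
   [reflections_free], which then kills every [a 0 i]. *)
have Su i : S i *m (\sum_i b 0 i *: u i) = \sum_i b 0 i *: u i.
  rewrite mulmx_sumr; apply: eq_bigr => j _; rewrite -scalemxAr /u.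
  rewrite mulmxDr mulmxBr -scalemxAr Sp Sp0 mulmx_sumr.
  by under eq_bigr do rewrite Sp.
have a0 := reflections_free Sw w0 Su rel.
move: rel; rewrite big1 ?add0r => [|i _]; last by rewrite a0 scale0r.
pose B := \sum_i b 0 i.
(* Regrouping by the [p i] brings the relation to the form of [permuted_coefs_eq], with [B *: p0] as
   the invariant vector. *)
have -> : \sum_i b 0 i *: u i =
    \sum_i (g%:R * b 0 i - B) *: p i + B *: p0.
  under eq_bigr do rewrite /u scalerDr scalerBr scalerA [_ * g%:R]mulrC.
  rewrite big_split sumrB /= -!scaler_suml; congr (_ + _).
  by rewrite scaler_sumr -sumrB; apply: eq_bigr => i _; rewrite scalerBl.
move=> rel; have ceq : forall i j, g%:R * b 0 i - B = g%:R * b 0 j - B.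
  apply: (permuted_coefs_eq Tp pI _ rel) => s.
  by rewrite -scalemxAr Tp0.
have gF0 : g%:R != 0 :> F by rewrite pnatr_eq0 -lt0n.
have beq i j : b 0 i = b 0 j by move: (ceq i j) => /addIr /(mulfI gF0).
(* Equal [b 0 i] make the coefficient of each [p i] vanish. Only [B *: p0 = 0] remains, which forces
   [B = 0] and then [b = 0]. *)
have gb i : g%:R * b 0 i = B.
  by rewrite /B (eq_bigr _ (fun j _ => beq j i)) sumr_const card_ord mulr_natl.
move: rel; rewrite big1 ?add0r => [/eqP|i _]; last by rewrite gb subrr scale0r.
rewrite scaler_eq0 (negPf p00) orbF => /eqP B0.
have -> : a = 0 by apply/rowP => i; rewrite a0 mxE.
have -> : b = 0.
  by apply/rowP => i; apply/(mulfI gF0); rewrite gb B0 mxE mulr0.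
exact: row_mx0.
Qed.

End linear_independence.

(** * General topology: subspaces, compact embeddings, matrices *)

Lemma set_type_hausdorff (X : topologicalType) (A : set X) :
  hausdorff_space X -> hausdorff_space A.
Proof.
move=> hX x y clxy; apply/val_inj/hX => U V nU nV.
have cv : continuous (set_val : A -> X) by exact: initial_continuous.
have [z [Uz Vz]] := clxy _ _ (cv x _ nU) (cv y _ nV).
by exists (val z).
Qed.

(** For [U] open, [e] sends the complement of [U] to a compact, hence closed, set. By injectivity,
    the complement of that set cuts out exactly the image of [U] on the range. *)
Lemma compact_embedding (X Y : topologicalType) (e : X -> Y) :
  compact [set: X] -> hausdorff_space Y -> continuous e -> injective e ->
  topological_embedding e.
Proof.
move=> cX hY ce eI; split => // U oU; exists (~` (e @` (~` U))).
  apply/closed_openC/(compact_closed hY)/continuous_compact.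
    exact: continuous_subspaceT.
  by apply: (subclosed_compact _ cX) => //; exact: open_closedC.
rewrite eqEsubset; split => [_ [x Ux <-]|y [+ [x _ xy]]].
  by split; [move=> [y nUy eyx]; apply: nUy; rewrite (eI _ _ eyx)|exists x].
rewrite -xy => nUx; exists x => //; apply: contrapT => Ux; apply: nUx.
by exists x.
Qed.

Lemma matrix_continuous (X T : topologicalType) (m n : nat)
    (f : X -> 'M[T]_(m, n)) :
  (forall i j, continuous (fun x => f x i j)) -> continuous f.
Proof.
move=> cf x U [P Pf PU].
have : \forall y \near x, forall i j, P i j (f y i j).
  apply: filter_forall => i; apply: filter_forall => j; exact: cf (Pf i j).
by apply: filterS => y Py; exact: PU.
Qed.

(** * Continuity of real and imaginary parts; compactness of the circle *)

Section complex_topology.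
Variable R : realType.

Lemma Re_continuous : continuous (fun z : Cplx R => complex.Re z).
Proof.
move=> z; apply/(cvgrPdist_lt (F := nbhs z)) => e e0; near=> w.
rewrite -raddfB -ltcR (le_lt_trans (normc_ge_Re _))//; near: w.
have e0' : 0 < (e%:C)%C :> Cplx R by rewrite ltcR.
exact: (@cvgr_dist_lt _ (Cplx R) _ (nbhs z) _ id z cvg_id _ e0').
Unshelve. all: by end_near. Qed.

(** The imaginary part of [z] is the real part of [- 'i * z]. *)
Lemma Im_continuous : continuous (fun z : Cplx R => complex.Im z).
Proof.
pose mulNi (z : Cplx R) : Cplx R := z * (- 'i%C : Cplx R).
have -> : (fun z : Cplx R => complex.Im z) =
          (fun z : Cplx R => complex.Re z) \o mulNi.
  by apply/funext => -[a b] /=; simpc.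
move=> z.
apply: (@continuous_comp _ _ _ mulNi (fun z : Cplx R => complex.Re z)).
  exact: mulrr_continuous.
exact: Re_continuous.
Qed.

Lemma real_complex_continuous : continuous (real_complex R : R -> Cplx R).
Proof.
move=> x; apply/(cvgrPdist_lt (F := nbhs x)) => e.
(* In the order on complex numbers a positive [e] is real, so its real part serves as the radius. *)
rewrite ltcE /= => /andP[/eqP ei e0].
have : \forall y \near x, `|x - y| < complex.Re e.
  by apply: (cvgr_dist_lt (F := nbhs x)).
apply: filterS => y; rewrite -rmorphB normc_def /= expr0n addr0 sqrtr_sqr.
by rewrite ltcE /= ei eqxx.
Qed.

Lemma circle_sumsq (z : circle R) :
  complex.Re (val z) ^+ 2 + complex.Im (val z) ^+ 2 = 1.
Proof.
have := set_mem (valP z); rewrite /circle /= => /(congr1 (fun u => u ^+ 2)).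
by rewrite -add_Re2_Im2 expr1n => /complexI.
Qed.

(** The circle is the continuous image of the segment from [- pi] to [pi] under
    [cos t + i sin t]. *)
Lemma circle_compact : compact [set: circle R].
Proof.
have cis1 t : (cos t +i* sin t)%C \in circle R.
  by rewrite inE /circle /= normc_def /= cos2Dsin2 sqrtr1.
pose cis t : circle R := SigSub (cis1 t).
have cis_cont : continuous cis.
  apply/continuous_comp_initial.
  have -> : set_val \o cis =
      fun t => (real_complex R (cos t) : Cplx R) +
               'i%C * real_complex R (sin t).
    by apply/funext => t; rewrite /= [LHS]complexE.
  move=> t; apply: cvgD.
    exact: (continuous_comp (@continuous_cos R t) (@real_complex_continuous _)).
  apply: cvgMl_tmp.
  exact: (continuous_comp (@continuous_sin R t) (@real_complex_continuous _)).
have -> : [set: circle R] = cis @` `[- pi, pi]%classic.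
  rewrite eqEsubset; split => // -[[x y] xy] _ /=.
  have xy1 : x ^+ 2 + y ^+ 2 = 1 := circle_sumsq (SigSub xy).
  have x1 : -1 <= x <= 1.
    rewrite -ler_norml -(@expr_le1 _ 2)// real_normK ?num_real// -xy1.
    by rewrite lerDl sqr_ge0.
  have pi0 := pi_ge0 R.
  have sinE : sin (acos x) = `|y|.
    by rewrite sin_acos// -xy1 addrC addKr sqrtr_sqr.
  (* The argument is [acos x] on the upper half circle and [- acos x] on the lower one. *)
  have [y0|y0] := leP 0 y.
    exists (acos x).
      rewrite /= in_itv /= acos_lepi// andbT (le_trans _ (acos_ge0 x1))//.
      by rewrite oppr_le0.
    by apply: val_inj; rewrite /= acosK// sinE ger0_norm.
  exists (- acos x).
    rewrite /= in_itv /= lerN2 acos_lepi//= (le_trans _ pi0)//.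
    by rewrite oppr_le0 acos_ge0.
  by apply: val_inj; rewrite /= cosN sinN acosK// sinE ltr0_norm// opprK.
apply: continuous_compact; last exact: segment_compact.
exact: continuous_subspaceT.
Qed.

End complex_topology.

Lemma bouquet_compact (R : realType) g : compact [set: bouquet R g].
Proof.
by apply: wedge_compact => [|i]; [exact: finite_finset|exact: circle_compact].
Qed.

(** * Antipodes, and the point [circle_i] that conjugation sends to its antipode *)

Section circle_points.
Variable R : realType.

Lemma circle_opp_subproof (z : circle R) : - val z \in circle R.
Proof. by have := set_mem (valP z); rewrite !inE /circle /= normrN. Qed.

Definition circle_opp (z : circle R) : circle R :=
  SigSub (circle_opp_subproof z).

Lemma circle_i_subproof : ('i%C : Cplx R) \in circle R.
Proof. by rewrite inE /circle /= normc_def /= expr0n expr1n add0r sqrtr1. Qed.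

Definition circle_i : circle R := SigSub circle_i_subproof.

Lemma circle_opp_neq (z : circle R) : circle_opp z != z.
Proof.
apply/eqP => /(congr1 val)/eqP /=; rewrite eqNr => /eqP z0.
have := set_mem (valP z); rewrite /circle /= z0 normr0 => /eqP.
by rewrite eq_sym oner_eq0.
Qed.

Lemma circle_conj_i : circle_conj circle_i = circle_opp circle_i.
Proof. by apply: val_inj; apply/eqP; rewrite eq_complex /= oppr0 !eqxx. Qed.

Lemma circle_conj_opp (z : circle R) :
  circle_conj (circle_opp z) = circle_opp (circle_conj z).
Proof. by apply: val_inj; rewrite /= rmorphN. Qed.

Lemma circle_oppK : involutive circle_opp.
Proof. by move=> z; apply: val_inj; rewrite /= opprK. Qed.

End circle_points.

(** * Embedding of the bouquet in a product of circles *)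

Section coordinates.
Variables (R : realType) (g : nat).
Local Notation B := (bouquet R g).

(** This is the retraction onto the circle of index [j], collapsing all the other circles to the
    base point. *)
Definition bq_coord (x : B) (j : 'I_g) : circle R :=
  @wedge_prod _ _ (fun _ : 'I_g => circle_one R) x j.

Lemma bq_coordE i z j :
  bq_coord (bq_pt i z) j = if j == i then z else circle_one R.
Proof.
rewrite /bq_coord /wedge_prod /bq_pt wedge_lift_funE => [|k l].
  by have [->|ji] := eqVneq j i; [rewrite dfwithin|rewrite dfwithout// eq_sym].
exact: (@wedge_prod_pointE _ _ (fun _ : 'I_g => circle_one R)).
Qed.

Lemma bq_coord_inj x y : bq_coord x =1 bq_coord y -> x = y.
Proof. by move=> xy; apply: wedge_prod_inj; apply/funext. Qed.

Lemma bq_coord_continuous j : continuous (bq_coord^~ j).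
Proof.
move=> x; apply: (@continuous_comp _ _ _
  (@wedge_prod _ _ (fun _ : 'I_g => circle_one R))
  (proj j)); last exact: proj_continuous.
exact: wedge_prod_continuous.
Qed.

Lemma bq_coord_tau s x j : bq_coord (tau s x) (s j) = bq_coord x j.
Proof.
have [i [z ->]] := bq_ptP x.
by rewrite tauE !bq_coordE (inj_eq perm_inj).
Qed.

Lemma bq_coord_rho i x j : bq_coord (rho i x) j =
  if j == i then circle_conj (bq_coord x j) else bq_coord x j.
Proof.
have [k [z ->]] := bq_ptP x; rewrite rhoE !bq_coordE.
have [->|jk] := eqVneq j k; first by [].
by rewrite circle_conj1 if_same.
Qed.

End coordinates.

(** * The lower bound on the dimension *)

Section lower_bound.
Variables (R : realType) (g n : nat) (e : bouquet R g -> sphere R n).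
Hypotheses (g_gt0 : (0 < g)%N) (equiv_e : equivariant_embedding e).

Lemma equivariant_embedding_dim : (g + g <= n.+1)%N.
Proof.
have [[_ eI _] [phi [_ _ _ phiE]]] := equiv_e.
have tauS s : SymB R g (tau s) by apply: generated_gen; left; exists s.
have rhoS i : SymB R g (rho i) by apply: generated_gen; right; exists i.
pose E x : 'cV[R]_n.+1 := val (e x).
have EI : injective E by move=> x y /val_inj /eI.
have Etau s x : phi (tau s) *m E x = E (tau s x) by exact: phiE.
have Erho i x : phi (rho i) *m E x = E (rho i x) by exact: phiE.
pose o := circle_one R; pose ii := circle_i R.
apply: (@signed_permutation_dim _ _ _ (fun i => phi (rho i))
  (fun s => phi (tau s)) (fun i => E (bq_pt i ii) - E (bq_pt i (circle_opp ii)))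
  (fun i => E (bq_pt i (circle_opp o))) (E (bq_pt (Ordinal g_gt0) o))) => //.
- move=> i j; rewrite mulmxBr !Erho !rhoE.
  case: ifP => // _.
  by rewrite circle_conj_opp circle_conj_i circle_oppK opprB.
- move=> i j; rewrite Erho rhoE.
  by case: ifP => // _; rewrite circle_conj_opp circle_conj1.
- by move=> i; rewrite Erho rhoE circle_conj1 if_same.
- by move=> s j; rewrite Etau tauE.
- by move=> s; rewrite Etau tauE; congr E; exact: bq_pt1.
(* The two points differ already in their coordinate of index [i]. *)
- move=> i; rewrite subr_eq0; apply/eqP => /EI /(congr1 (@bq_coord R g ^~ i)).
  by rewrite !bq_coordE eqxx; apply/eqP; rewrite eq_sym circle_opp_neq.
- move=> i j /EI /(congr1 (@bq_coord R g ^~ i)).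
  rewrite !bq_coordE eqxx; case: eqP => // _ /eqP.
  by rewrite (negPf (circle_opp_neq _)).
- apply/eqP => E0; have := set_mem (valP (e (bq_pt (Ordinal g_gt0) o))).
  rewrite /sphere /= -/(E _) E0 big1 => [/eqP|i _]; last by rewrite mxE expr0n.
  by rewrite eq_sym oner_eq0.
Qed.

End lower_bound.

(** * The equivariant embedding in the sphere *)

Section sphere_map.
Variables (R : realType) (g n : nat).
Variables (idx : 'I_n.+1 -> 'I_g * bool) (pos : 'I_g * bool -> 'I_n.+1).
Hypotheses (idxK : cancel idx pos) (posK : cancel pos idx) (g_gt0 : (0 < g)%N).

Definition part (b : bool) (z : Cplx R) : R :=
  if b then complex.Im z else complex.Re z.

(** [idx] labels the real coordinates by a circle and a choice of real or imaginary part. Each of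
    the [g] circles contributes 1 to the squared norm, whence the division by the root of [g]. *)
Definition coord_vec (x : bouquet R g) : 'cV[R]_n.+1 :=
  \col_k (part (idx k).2 (val (bq_coord x (idx k).1)) / Num.sqrt g%:R).

Lemma sqrtg_neq0 : Num.sqrt g%:R != 0 :> R.
Proof. by rewrite sqrtr_eq0 -ltNge ltr0n. Qed.

Lemma coord_vec_sphere x : coord_vec x \in sphere R n.
Proof.
rewrite inE /sphere /=; under eq_bigr do rewrite mxE expr_div_n.
rewrite -mulr_suml sqr_sqrtr ?ler0n//.
rewrite (reindex pos) /=; last by exists idx => k _; rewrite ?posK ?idxK.
under eq_bigr do rewrite posK.
rewrite -(pair_bigA _ (fun j b => part b (val (bq_coord x j)) ^+ 2)) /=.
rewrite (eq_bigr (fun _ => 1)) => [|j _].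
  by rewrite sumr_const card_ord divff// pnatr_eq0 -lt0n.
by rewrite big_bool /= addrC circle_sumsq.
Qed.

Definition sphere_map x : sphere R n := SigSub (coord_vec_sphere x).

Lemma sphere_map_continuous : continuous sphere_map.
Proof.
apply/continuous_comp_initial; apply: matrix_continuous => k l.
have -> : (fun x => (set_val \o sphere_map) x k l) =
    *%R^~ (Num.sqrt g%:R)^-1 \o
    (part (idx k).2 \o fun x => set_val (bq_coord x (idx k).1)).
  by apply/funext => x; rewrite /= mxE.
have cont_val : continuous
    (fun x : bouquet R g => set_val (bq_coord x (idx k).1) : Cplx R).
  move=> x.
  apply: (@continuous_comp _ _ _ (@bq_coord R g ^~ (idx k).1) set_val).
    exact: bq_coord_continuous.
  exact: initial_continuous.
have cont_part : continuous (part (idx k).2).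
  by case: (idx k).2; [exact: Im_continuous|exact: Re_continuous].
move=> x; apply: (continuous_comp (continuous_comp (cont_val x) (cont_part _))).
exact: mulrr_continuous.
Qed.

Lemma coord_vec_inj : injective coord_vec.
Proof.
move=> x y xy; apply: bq_coord_inj => j; apply/val_inj/eqP.
have partE b : part b (val (bq_coord x j)) = part b (val (bq_coord y j)).
  have := congr1 (fun v : 'cV_n.+1 => v (pos (j, b)) 0) xy.
  by rewrite !mxE posK /= => /(mulIf (invr_neq0 sqrtg_neq0)).
have /= ReE := partE false; have /= ImE := partE true.
by rewrite eq_complex ReE ImE !eqxx.
Qed.

Lemma sphere_map_embedding : topological_embedding sphere_map.
Proof.
apply: compact_embedding.
- exact: bouquet_compact.
- exact/set_type_hausdorff/norm_hausdorff.
- exact: sphere_map_continuous.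
- by move=> x y /(congr1 val) /coord_vec_inj.
Qed.

(** The image spans the whole space: the difference of two antipodal points of one circle, at 1 or
    at ['i], is a nonzero multiple of a standard basis vector. *)
Lemma coord_vec_ext (A C : 'M[R]_n.+1) :
  (forall x, A *m coord_vec x = C *m coord_vec x) -> A = C.
Proof.
move=> AC; apply/eqP; rewrite -subr_eq0; apply/eqP; set D := A - C.
have D0 x : D *m coord_vec x = 0 by rewrite mulmxBl AC subrr.
apply/matrixP => k l; rewrite [RHS]mxE.
case El : (idx l) => [j b].
pose z := if b then circle_i R else circle_one R.
have zE : coord_vec (bq_pt j z) - coord_vec (bq_pt j (circle_opp z)) =
    (2 / Num.sqrt g%:R) *: delta_mx l 0.
  apply/colP => l'; rewrite !mxE eqxx andbT -mulrBl !bq_coordE.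
  rewrite mulrAC -(inj_eq (can_inj idxK)) El.
  case: (idx l') => j' b'; rewrite xpair_eqE /=; congr (_ / _).
  have [_|_] := eqVneq j' j; last by rewrite subrr mulr0.
  rewrite /z; case: b b' {El z} => -[] /=;
  by rewrite ?opprK ?oppr0 ?addr0 ?mulr0 ?mulr1.
have : D *m (coord_vec (bq_pt j z) - coord_vec (bq_pt j (circle_opp z))) = 0.
  by rewrite mulmxBr !D0 subrr.
rewrite zE -scalemxAr -colE => /colP/(_ k)/eqP; rewrite !mxE.
rewrite !mulf_eq0 invr_eq0 (negPf sqrtg_neq0) pnatr_eq0 /=.
by move/eqP.
Qed.

Lemma orthogonal_lift h : SymB R g h -> exists A : 'M[R]_n.+1,
  orthogonal_group R n.+1 A /\ forall x, A *m coord_vec x = coord_vec (h x).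
Proof.
elim=> {h} [h [[s _ <-]|[i _ <-]]| |h k _ [A [oA AE]] _ [C [oC CE]]|].
(* The inverse of [s] appears because the coordinate of [tau s x] at [j] is that of [x] at the
   preimage of [j] under [s]. *)
- have sI : injective (fun k => pos ((s^-1)%g (idx k).1, (idx k).2)).
    move=> k l /(can_inj posK) [/perm_inj k1 k2].
    apply: (can_inj idxK).
    by rewrite [LHS]surjective_pairing k1 k2 -surjective_pairing.
  exists (perm_mx (perm sI)); split.
    by rewrite /orthogonal_group /= tr_perm_mx -perm_mxM mulVg perm_mx1.
  move=> x; rewrite -row_permE; apply/colP => k; rewrite !mxE permE posK /=.
  by rewrite -{2}[(idx k).1](permKV s) bq_coord_tau.
(* Conjugation on the circle [i] changes the sign of one real coordinate, its imaginary part. *)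
- pose d : 'rV[R]_n.+1 := \row_k (if idx k == (i, true) then -1 else 1).
  exists (diag_mx d); split.
    rewrite /orthogonal_group /= tr_diag_mx mulmx_diag -diag_const_mx.
    congr diag_mx; apply/rowP => k; rewrite !mxE.
    by case: ifP; rewrite ?mulrNN mulr1.
  move=> x; rewrite mul_diag_mx; apply/colP => k; rewrite !mxE bq_coord_rho.
  case: (idx k) => j b; rewrite xpair_eqE /=.
  have [->|_] := eqVneq j i; last by rewrite mul1r.
  case: b; rewrite /= ?mul1r ?mulN1r; case: (val _) => //= u v.
  by rewrite mulNr.
- exists 1%:M; split; first by rewrite /orthogonal_group /= trmx1 mul1mx.
  by move=> x; rewrite mul1mx.
- exists (A *m C); split; last by move=> x; rewrite -mulmxA CE AE.
  by rewrite /orthogonal_group /= trmx_mul -mulmxA [A^T *m _]mulmxA oA mul1mx.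
(* The inverse of an orthogonal matrix is its transpose. *)
- move=> h k _ [A [oA AE]] hk kh; exists A^T; split.
    by rewrite /orthogonal_group /= trmxK; exact: mulmx1C.
  by move=> x; rewrite -{1}[x]kh -AE mulmxA oA mul1mx.
Qed.

Lemma sphere_map_equivariant : equivariant_embedding sphere_map.
Proof.
split; first exact: sphere_map_embedding.
(* On [SymB R g] the default [0] is never taken, by [orthogonal_lift]. *)
pose phi h : 'M[R]_n.+1 := xget 0 [set A | orthogonal_group R n.+1 A /\
  forall x, A *m coord_vec x = coord_vec (h x)].
have phiP h : SymB R g h -> orthogonal_group R n.+1 (phi h) /\
    forall x, phi h *m coord_vec x = coord_vec (h x).
  by move=> /orthogonal_lift; exact: xgetPex.
exists phi; split=> [h /phiP[]//|h k Sh Sk|h k Sh Sk hk|h x /phiP[_ ->]//].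
  apply: coord_vec_ext => x; have [_ hE] := phiP h Sh.
  have [_ kE] := phiP k Sk; have [_ ->] := phiP _ (generated_comp Sh Sk).
  by rewrite -mulmxA kE hE.
have [_ hE] := phiP h Sh; have [_ kE] := phiP k Sk.
by apply/funext => x; apply: coord_vec_inj; rewrite -hE -kE hk.
Qed.

End sphere_map.

Theorem theorem0p2 (R : realType) (g : nat) (hg : (1 < g)%N) :
  (exists e : bouquet R g -> sphere R (2 * g - 1)%N,
     equivariant_embedding e) /\
  (forall n : nat,
     (exists e : bouquet R g -> sphere R n, equivariant_embedding e) ->
     (2 * g - 1 <= n)%N).
Proof.
have g0 : (0 < g)%N by exact: ltnW.
split=> [|n [e /(equivariant_embedding_dim g0)]]; last first.
  by rewrite addnn -mul2n leq_subLR add1n.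
(* The sphere of dimension [2 * g - 1] lies in a space of dimension [2 * g], the subtraction not
   being truncated since [g] is positive. The pairs of a circle and a part index its coordinates. *)
have E : (2 * g - 1).+1 = #|{: 'I_g * bool}|.
  by rewrite card_prod card_ord card_bool mulnC subn1 prednK// muln_gt0 g0.
have idxK : cancel (enum_val \o cast_ord E) (cast_ord (esym E) \o enum_rank).
  by move=> k; rewrite /= enum_valK cast_ordK.
have posK : cancel (cast_ord (esym E) \o enum_rank) (enum_val \o cast_ord E).
  by move=> x; rewrite /= cast_ordKV enum_rankK.
by exists (sphere_map idxK posK g0); exact: sphere_map_equivariant.
Qed.
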